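(* Let $\Gamma=(x_1,\dots,x_n)$ and $\Gamma'=(x'_1,\dots,x'_n)$ be ordered point clouds in the same metric space $(X,d)$, and set $$\varepsilon=\max_{1\le i\le n}d(x_i,x'_i),\qquad R=\max\{R_\Gamma,R_{\Gamma'}\}.$$ Take chain complexes with coefficients in an arbitrary ring $\Lambda$. For every $r>R$, the identity on the index sets induces inclusions $$\iota\colon C_\bullet(\mathrm{DC}_r(\Gamma))\hookrightarrow C_\bullet(\mathrm{DC}_{r+\varepsilon}(\Gamma')),\qquad \jmath\colon C_{\bullet}(\check{\mathrm C}_r(\Gamma))\hookrightarrow C_{\bullet}(\check{\mathrm C}_{r+\varepsilon}(\Gamma')),$$ $$\iota'\colon C_\bullet(\mathrm{DC}_r(\Gamma'))\hookrightarrow C_\bullet(\mathrm{DC}_{r+\varepsilon}(\Gamma)),\qquad \jmath'\colon C_{\bullet}(\check{\mathrm C}_r(\Gamma'))\hookrightarrow C_{\bullet}(\check{\mathrm C}_{r+\varepsilon}(\Gamma)),$$ and these satisfy $$\jmath\circ\psi_{\Gamma,r}=\psi_{\Gamma',r+\varepsilon}\circ\iota\qquad\text{and}\qquad \jmath'\circ\psi_{\Gamma',r}=\psi_{\Gamma,r+\varepsilon}\circ\iota',$$ where $\psi_{\Gamma,r}$ denotes the distance-to-Čech map of $\Gamma$ at radius $r$ (and similarly for $\Gamma'$).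
   Context: $B(x,r)=\{y\in X\mid d(x,y)<r\}$ is the open ball. An ordered point cloud of length $n$ is a finite indexed family $\Gamma=(x_1,\dots,x_n)$ of (not necessarily distinct) points of $X$. Čech complex: $\check{\mathrm C}_r(\Gamma)$ is the simplicial complex whose simplices are the nonempty $\sigma\subset\{1,\dots,n\}$ with $\bigcap_{i\in\sigma}B(x_i,r)\neq\emptyset$. Its vertices are indices, so repeated points may give distinct vertices. Sample radius: $R_\Gamma=\inf\{r\ge 0\mid B(x_{i-1},r)\cap B(x_i,r)\neq\emptyset\text{ for all }2\le i\le n\}$. Elementary cubes in $\mathbb{R}^2$ are the products $I_1\times I_2$ with each $I_m$ either $[k,k]$ (also written $[k]$) or $[k,k+1]$, $k\in\mathbb{Z}$; the dimension is the number of factors of the form $[k,k+1]$. A cubical complex is a set of elementary cubes closed under faces (elementary cubes contained in a member). $C_k(K)$ is the free $\Lambda$-module on the $k$-dimensional cubes of $K$, with boundary $\partial([i]\times[j])=0$, $\partial([i]\times[j,j+1])=[i]\times[j+1]-[i]\times[j]$, $\partial([i,i+1]\times[j])=[i+1]\times[j]-[i]\times[j]$, $\partial([i,i+1]\times[j,j+1])=[i+1]\times[j,j+1]-[i]\times[j,j+1]-[i,i+1]\times[j+1]+[i,i+1]\times[j]$. Distance complex: $\mathrm{DC}_r(\Gamma)$ is the cubical complex of all elementary cubes $[i,j]\times[k,l]\subset[1,n]^2$ (so $j\in\{i,i+1\}$, $l\in\{k,k+1\}$) with $j\le k$ and $\{i,j,k,l\}\in\check{\mathrm C}_r(\Gamma)$.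 Simplicial chains are spanned by oriented simplices $[v_0,\dots,v_k]$ (alternating in the vertices; a symbol with a repeated vertex is zero). For $1\le i\le j\le n$ put $c_\Gamma(i,j)=\sum_{k=i+1}^{j}[k-1,k]$. For $r>R_\Gamma$, the distance-to-Čech map $\psi_{\Gamma,r}\colon C_\bullet(\mathrm{DC}_r(\Gamma))\to C_{\bullet+1}(\check{\mathrm C}_r(\Gamma))$ is the degree-one chain map (homomorphisms $C_k\to C_{k+1}$ commuting with boundaries) that is the linear extension of: for a vertex $v=(i,j)=[i]\times[j]$, $\psi_{\Gamma,r}(v)=c_\Gamma(i,j)-[i,j]$; for edges, $\psi_{\Gamma,r}([i,i+1]\times[j])=[i,j,i+1]$ and $\psi_{\Gamma,r}([i]\times[j,j+1])=[i,j,j+1]$; for squares, $\psi_{\Gamma,r}([i,i+1]\times[j,j+1])=[i,i+1,j,j+1]$. *)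

(* Defs.v *)
From HB Require Import structures.
From mathcomp Require Import all_boot all_order all_algebra finmap.
From mathcomp Require Import all_classical all_reals all_analysis.
From mathcomp Require Import zify ring lra.
Set Implicit Arguments.
Unset Strict Implicit.
Unset Printing Implicit Defensive.
Import Order.TTheory GRing.Theory Num.Theory.
Local Open Scope fset_scope.
Local Open Scope ring_scope.

Section FreeModule.
Context (L : pzRingType) (T : choiceType).
Implicit Type S : {fset T}.

Definition freemod S : lmodType L := {ffun S -> L^o}.

(* [gen S c] is zero when [c] is not in [S]. *)
Definition gen S (c : T) : freemod S := [ffun s : S => (val s == c)%:R].

Definition linext S (V : lmodType L) (f : T -> V) (x : freemod S) : V :=
  \sum_(s : S) (x s : L) *: f (val s).

Fact linext_is_linear S V f : linear (@linext S V f).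
Proof.
move=> a x y; rewrite /linext scaler_sumr -big_split /=.
by apply: eq_bigr => s _; rewrite !ffunE scalerDl scalerA.
Qed.

HB.instance Definition _ S (V : lmodType L) (f : T -> V) :=
  GRing.isLinear.Build L (freemod S) V *:%R (linext f)
    (@linext_is_linear S V f).

Lemma linext_gen S V f c : c \in S -> @linext S V f (gen S c) = f c.
Proof.
move=> cS; rewrite /linext (bigD1 [` cS]) //= ffunE eqxx scale1r big1 ?addr0 //.
move=> s; rewrite -val_eqE /= ffunE => /negbTE ->.
by rewrite scale0r.
Qed.

Lemma gen_notin S c : c \notin S -> gen S c = 0.
Proof.
move=> cS; apply/ffunP => s; rewrite !ffunE; case: eqP => // e.
by case/negP: cS; rewrite -e; apply: valP.
Qed.

Lemma gen_expand S (x : freemod S) : x = \sum_(s : S) (x s : L) *: gen S (val s).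
Proof.
apply/ffunP => t; rewrite sum_ffunE (bigD1 t) //= !ffunE eqxx big1.
  by rewrite addr0 /GRing.scale /= mulr1.
move=> s st; rewrite !ffunE eq_sym (inj_eq val_inj) (negbTE st).
by rewrite scaler0.
Qed.

Lemma linear_genP S (V : lmodType L) (f g : {linear freemod S -> V}) :
  (forall c, c \in S -> f (gen S c) = g (gen S c)) -> forall x, f x = g x.
Proof.
move=> fg x; rewrite (gen_expand x) !linear_sum; apply: eq_bigr => s _.
by rewrite !linearZ /= fg //; apply: valP.
Qed.

End FreeModule.

Record chain_complex (L : pzRingType) := ChainComplex {
  chains :> nat -> lmodType L;
  bd : forall k, {linear chains k.+1 -> chains k};
  bd_bd : forall k x, bd k (bd k.+1 x) = 0
}.

Definition is_chain_map (L : pzRingType) (C D : chain_complex L)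
    (f : forall k, {linear C k -> D k}) :=
  forall k x, bd D k (f k.+1 x) = f k (bd C k x).

(* Complexes are zero in degree -1, hence the separate condition in degree 0. *)
Record degree1_chain_map (L : pzRingType) (C D : chain_complex L) :=
  Degree1ChainMap {
  deg1_fun :> forall k, {linear C k -> D k.+1};
  deg1_bd0 : forall x, bd D 0 (deg1_fun 0 x) = 0;
  deg1_bdS : forall k x, bd D k.+1 (deg1_fun k.+1 x) = deg1_fun k (bd C k x)
}.

(* (k, false) is [k, k] and (k, true) is [k, k + 1]. Only cubes with
   nonnegative coordinates are needed, as all complexes lie in [1, n]^2. *)
Definition elem_interval : choiceType := (nat * bool)%type.
Definition pt (k : nat) : elem_interval := (k, false).
Definition seg (k : nat) : elem_interval := (k, true).
Definition lo (I : elem_interval) : nat := I.1.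
Definition hi (I : elem_interval) : nat := (I.1 + I.2)%N.

Definition cube : choiceType := (elem_interval * elem_interval)%type.
Definition cube_dim (c : cube) : nat := (c.1.2 + c.2.2)%N.

Definition subinterval (I J : elem_interval) := (lo J <= lo I)%N && (hi I <= hi J)%N.
Definition face (c d : cube) := subinterval c.1 d.1 && subinterval c.2 d.2.

Record cubical_complex := CubicalComplex {
  cubes :> {fset cube};
  cubes_closed : forall c d, d \in cubes -> face c d -> c \in cubes
}.

Definition cubes_of_dim (K : cubical_complex) k : {fset cube} :=
  [fset c in (K : {fset cube}) | cube_dim c == k].

Lemma mem_cubes_of_dim (K : cubical_complex) k (c : cube) :
  (c \in cubes_of_dim K k) = (c \in (K : {fset cube})) && (cube_dim c == k).
Proof. by rewrite !inE. Qed.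

Record simplicial_complex := SimplicialComplex {
  simplices :> {fset {fset nat}};
  simplices_neq0 : forall s, s \in simplices -> s != fset0;
  simplices_closed : forall s t, t \in simplices -> s != fset0 -> s `<=` t ->
    s \in simplices
}.

Definition simplices_of_dim (K : simplicial_complex) k : {fset {fset nat}} :=
  [fset s in (K : {fset {fset nat}}) | #|` s| == k.+1].

Lemma zmod_square (V : zmodType) (a b c d : V) :
  a - b - (c - d) - (a - c) + (b - d) = 0.
Proof.
have -> : a - b - (c - d) = a - c - (b - d).
  by rewrite !opprB addrACA [in RHS]addrACA [- b + _]addrC.
by rewrite addrAC addrNK subrr.
Qed.

Section Cubical.
Context (L : pzRingType) (K : cubical_complex).

Definition cubical_chain k : lmodType L := freemod L (cubes_of_dim K k).

(* The terms have degree [k] when [c] has dimension [k.+1]. *)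
Definition cube_bd k (c : cube) : cubical_chain k :=
  let g I J : cubical_chain k := gen L (cubes_of_dim K k) (I, J) in
  match c with
  | ((i, false), (j, false)) => 0
  | ((i, false), (j, true)) => g (pt i) (pt j.+1) - g (pt i) (pt j)
  | ((i, true), (j, false)) => g (pt i.+1) (pt j) - g (pt i) (pt j)
  | ((i, true), (j, true)) =>
      g (pt i.+1) (seg j) - g (pt i) (seg j) - g (seg i) (pt j.+1)
      + g (seg i) (pt j)
  end.

Definition cubical_bd k : {linear cubical_chain k.+1 -> cubical_chain k} :=
  linext (cube_bd k).

Lemma cubical_bd_gen k c : c \in cubes_of_dim K k.+1 ->
  cubical_bd k (gen L (cubes_of_dim K k.+1) c) = cube_bd k c.
Proof. exact: linext_gen. Qed.

Lemma cubical_bd_bd k x : cubical_bd k (cubical_bd k.+1 x) = 0.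
Proof.
pose f : {linear cubical_chain k.+2 -> cubical_chain k} :=
  cubical_bd k \o cubical_bd k.+1.
pose z : {linear cubical_chain k.+2 -> cubical_chain k} := \0.
suff: f x = z x by [].
apply: linear_genP => c cK; rewrite /f /z /= cubical_bd_gen //.
move: cK; rewrite !inE /cube_dim /= => /andP[].
case: c => [[i [] ] [j [] ]] //= cK /eqP [] // k0; subst k.
have fK c : face c (seg i, seg j) -> cube_dim c == 1 -> c \in cubes_of_dim K 1.
  by move=> fc dc; rewrite !inE /= dc (cubes_closed cK fc).
rewrite linearD !linearB /= !cubical_bd_gen ?fK //=;
  try by rewrite /face /subinterval /lo /hi /=; lia.
exact: zmod_square.
Qed.

Definition cubical_chains : chain_complex L :=
  ChainComplex cubical_bd_bd.

End Cubical.

Section Simplicial.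
Context (L : pzRingType) (K : simplicial_complex).

Definition simplicial_chain k : lmodType L := freemod L (simplices_of_dim K k).

(* A simplex stands for the symbol of its vertices in increasing order; the
   exponent is the position of [v] in that order. *)
Definition simplex_bd k (s : {fset nat}) : simplicial_chain k :=
  \sum_(v <- s) (-1) ^+ count (fun u => u < v)%N s *:
    (gen L (simplices_of_dim K k) (s `\ v) : simplicial_chain k).

Definition simplicial_bd k : {linear simplicial_chain k.+1 -> simplicial_chain k} :=
  linext (simplex_bd k).

Lemma simplicial_bd_gen k s : s \in simplices_of_dim K k.+1 ->
  simplicial_bd k (gen L (simplices_of_dim K k.+1) s) = simplex_bd k s.
Proof. exact: linext_gen. Qed.

Lemma simplicial_bd_bd k x : simplicial_bd k (simplicial_bd k.+1 x) = 0.
Proof.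
pose f : {linear simplicial_chain k.+2 -> simplicial_chain k} :=
  simplicial_bd k \o simplicial_bd k.+1.
pose z : {linear simplicial_chain k.+2 -> simplicial_chain k} := \0.
suff: f x = z x by [].
apply: linear_genP => s sK; rewrite /f /z /= simplicial_bd_gen //.
pose F v u : simplicial_chain k :=
  (-1) ^+ (count (fun w => w < v)%N s + count (fun w => w < u)%N (s `\ v)) *:
    (gen L (simplices_of_dim K k) (s `\ v `\ u) : simplicial_chain k).
have -> : simplicial_bd k (simplex_bd k.+1 s) =
    \sum_(v <- s) \sum_(u <- s | v != u) F v u.
  rewrite linear_sum big_seq [RHS]big_seq; apply: eq_bigr => v vs.
  rewrite linearZ /= simplicial_bd_gen; last first.
    move: sK; rewrite !inE => /andP[sK /eqP cs].
    have cv : #|` s `\ v| = k.+2 by have := cardfsD1 v s; rewrite vs cs; lia.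
    rewrite cv eqxx andbT; apply: simplices_closed sK _ (fsubD1set _ _).
    by rewrite -cardfs_gt0 cv.
  have pE : perm_eq [seq u <- s | v != u] (s `\ v)%fset.
    apply: uniq_perm; rewrite ?filter_uniq ?fset_uniq // => u.
    by rewrite mem_filter !inE eq_sym.
  rewrite scaler_sumr -[RHS]big_filter (perm_big _ pE) /=.
  by apply: eq_bigr => u _; rewrite scalerA -exprD.
have Fanti v u : v \in s -> u \in s -> (v < u)%N -> F u v = - F v u.
  move=> vs us vu; rewrite /F -scaleNr.
  rewrite (_ : s `\ u `\ v = s `\ v `\ u)%fset; last first.
    by rewrite !fsetDDl fsetUC.
  have cnt p y : y \in s ->
      count p (s : {fset nat}) = (p y + count p (s `\ y)%fset)%N.
    move=> ys; have /permP -> : perm_eq s (y :: (s `\ y)%fset).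
      apply: uniq_perm; rewrite /= ?fset_uniq ?andbT ?inE ?eqxx // => t.
      by rewrite !inE; case: eqP => // ->.
    by [].
  rewrite (cnt (fun w => w < u)%N v vs) (cnt (fun w => w < v)%N u us) vu.
  by rewrite ltnNge (ltnW vu) /= add1n add0n addSn exprS mulN1r [in RHS]addnC.
rewrite (eq_bigr (fun v => \sum_(u <- s | (v < u)%N) F v u +
    \sum_(u <- s | (u < v)%N) F v u)) => [|v _]; last first.
  rewrite (bigID (fun u => v < u)%N) /=; congr (_ + _); apply: eq_bigl => u.
    by rewrite neq_ltn; case: (ltngtP u v).
  by rewrite neq_ltn; case: (ltngtP u v).
rewrite big_split /= [X in _ + X](exchange_big_dep xpredT) //= -big_split /=.
rewrite big_seq big1 // => v vs; rewrite -big_split /= big_seq_cond big1 // => u.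
by case/andP=> us vu; rewrite (Fanti v u) ?subrr.
Qed.

Definition simplicial_chains : chain_complex L :=
  ChainComplex simplicial_bd_bd.

(* The parity of the sorting permutation of [v] is that of [inversions v]. *)
Fixpoint inversions (v : seq nat) : nat :=
  if v is x :: v' then (count (fun y => y < x) v' + inversions v')%N else 0.

(* The oriented simplex on the vertices listed in [v]. *)
Definition symb k (v : seq nat) : simplicial_chain k :=
  if uniq v then
    (-1) ^+ inversions v *: gen L (simplices_of_dim K k) [fset x in v]
  else 0.

Lemma symb_nuniq k v : ~~ uniq v -> symb k v = 0.
Proof. by rewrite /symb => /negbTE ->. Qed.

Lemma symb_sorted k v : path.sorted ltn v ->
  symb k v = gen L (simplices_of_dim K k) [fset x in v].
Proof.
move=> sv; rewrite /symb (sorted_uniq ltn_trans ltnn sv).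
suff -> : inversions v = 0%N by rewrite expr0 scale1r.
elim: v sv => //= x v IH pv; rewrite IH ?(path_sorted pv) // addn0.
apply/eqP; rewrite -leqn0 leqNgt -has_count; apply/hasPn => y yv.
have /allP/(_ _ yv) /= : all (ltn x) v by apply: order_path_min pv; apply: ltn_trans.
by rewrite -leqNgt => /ltnW.
Qed.

Lemma symb_swap23 k a b c : (a < c <= b)%N ->
  symb k [:: a; b; c] = - symb k [:: a; c; b].
Proof.
case/andP=> ac; rewrite leq_eqVlt => /predU1P[->|cb].
  by rewrite !symb_nuniq ?oppr0 //= !inE eqxx ?andbF ?orbT.
rewrite [in RHS]symb_sorted /=; last by rewrite ac cb.
rewrite /symb /= !inE !negb_or.
have -> : [fset x in [:: a; b; c]] = [fset x in [:: a; c; b]].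
  by apply/fsetP => y; rewrite !inE; case: (y == a); case: (y == b); case: (y == c).
have [-> -> ->] : [/\ a != b, a != c & b != c] by split; apply/eqP; lia.
have [-> -> ->] : [/\ (b < a)%N = false, (c < a)%N = false & (c < b)%N].
  by split; lia.
by rewrite /= expr1 scaleN1r.
Qed.

Lemma simplicial_bd_symb k v : path.sorted ltn v -> size v = k.+2 ->
    [fset x in v] \in (K : {fset {fset nat}}) ->
  simplicial_bd k (symb k.+1 v) =
    \sum_(0 <= i < size v) (-1) ^+ i *: symb k (take i v ++ drop i.+1 v).
Proof.
move=> sv kv vK; have uv := sorted_uniq ltn_trans ltnn sv.
have pv : perm_eq [fset x in v] v.
  by apply: uniq_perm; rewrite ?fset_uniq // => x; rewrite !inE.
rewrite symb_sorted // simplicial_bd_gen; last first.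
  by rewrite !inE vK /= -kv (perm_size pv) eqxx.
rewrite /simplex_bd (perm_big _ pv) (big_nth 0%N) big_seq [RHS]big_seq.
apply: eq_bigr => i; rewrite mem_index_iota /= => iv.
rewrite (permP pv) (count_lt_nth 0%N _ iv) ?ltEnat //; congr (_ *: _).
rewrite symb_sorted; last first.
  apply: subseq_sorted sv; first exact: ltn_trans.
  rewrite -[X in subseq _ X](cat_take_drop i) cat_subseq //.
  by rewrite (drop_nth 0%N iv) subseq_cons.
congr gen; apply/fsetP => x; rewrite !inE.
have := uv; rewrite -[v in uniq v](cat_take_drop i) (drop_nth 0%N iv) cat_uniq /=.
case/and3P=> _ /norP[n1 _] /andP[n2 _].
rewrite -[v in _ && (_ \in v)](cat_take_drop i) (drop_nth 0%N iv).
rewrite !mem_cat inE; case: eqP => [->|] //=.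
by rewrite (negbTE n1) (negbTE n2).
Qed.

Lemma bd_symb2 a b : (a <= b)%N ->
    [fset x in [:: a; b]] \in (K : {fset {fset nat}}) ->
  simplicial_bd 0 (symb 1 [:: a; b]) = symb 0 [:: b] - symb 0 [:: a].
Proof.
rewrite leq_eqVlt => /predU1P[->|ab] abK.
  by rewrite symb_nuniq ?linear0 ?subrr //= inE eqxx.
rewrite simplicial_bd_symb //= ?ab // !big_nat_recr //= big_nil.
by rewrite add0r expr0 scale1r expr1 scaleN1r.
Qed.

Lemma bd_symb3 a b c : (a <= b <= c)%N ->
    [fset x in [:: a; b; c]] \in (K : {fset {fset nat}}) ->
  simplicial_bd 1 (symb 2 [:: a; b; c]) =
    symb 1 [:: b; c] - symb 1 [:: a; c] + symb 1 [:: a; b].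
Proof.
case/andP; rewrite leq_eqVlt => /predU1P[->|ab].
  rewrite (@symb_nuniq 2) ?(@symb_nuniq 1 [:: b; b]) /= ?inE ?eqxx //.
  by rewrite linear0 subrr addr0.
rewrite leq_eqVlt => /predU1P[->|bc] abK.
  rewrite (@symb_nuniq 2) ?(@symb_nuniq 1 [:: c; c]) /= ?inE ?eqxx ?andbF //.
  by rewrite linear0 add0r addNr.
rewrite simplicial_bd_symb //= ?ab ?bc // !big_nat_recr //= big_nil.
by rewrite add0r expr0 scale1r expr1 scaleN1r sqrrN expr1n scale1r.
Qed.

Lemma bd_symb4 a b c d : (a < b)%N -> (b <= c)%N -> (c < d)%N ->
    [fset x in [:: a; b; c; d]] \in (K : {fset {fset nat}}) ->
  simplicial_bd 2 (symb 3 [:: a; b; c; d]) =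
    symb 2 [:: b; c; d] - symb 2 [:: a; c; d] + symb 2 [:: a; b; d]
    - symb 2 [:: a; b; c].
Proof.
move=> ab; rewrite leq_eqVlt => /predU1P[->|bc] cd abK.
  rewrite (@symb_nuniq 3) ?(@symb_nuniq 2 [:: c; c; d]) ?(@symb_nuniq 2 [:: a; c; c])
    /= ?inE ?eqxx ?andbF //.
  by rewrite linear0 add0r addNr subr0.
rewrite simplicial_bd_symb //= ?ab ?bc ?cd // !big_nat_recr //= big_nil.
rewrite add0r expr0 scale1r expr1 scaleN1r sqrrN expr1n scale1r.
by rewrite exprS sqrrN expr1n mulr1 scaleN1r.
Qed.

End Simplicial.

Section Inclusions.
Context (L : pzRingType).

(* Meaningful when [K] is a subcomplex of [K']. *)
Definition cubical_incl (K K' : cubical_complex) k :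
    {linear cubical_chains L K k -> cubical_chains L K' k} :=
  linext (gen L (cubes_of_dim K' k)).

Definition simplicial_incl (K K' : simplicial_complex) k :
    {linear simplicial_chains L K k -> simplicial_chains L K' k} :=
  linext (gen L (simplices_of_dim K' k)).

Definition induces_cubical_inclusion (K K' : cubical_complex) :=
  [/\ K `<=` K', is_chain_map (cubical_incl K K')
    & forall k, injective (cubical_incl K K' k)].

Definition induces_simplicial_inclusion (K K' : simplicial_complex) :=
  [/\ K `<=` K', is_chain_map (simplicial_incl K K')
    & forall k, injective (simplicial_incl K K' k)].

End Inclusions.

Section PointCloud.
Context (R : realType) (X : metricType R) (n : nat).
Implicit Types (G : 'I_n -> X) (r : R).
Local Open Scope classical_set_scope.

(* [G i] is the point with index [i.+1] in the clouds x_1, ..., x_n; vertices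
   of the Cech complex and coordinates of cubes are the indices 1, ..., n. *)
Definition cech_simplex G r (s : {fset nat}) : Prop :=
  s != fset0 /\ exists y : X, forall i : 'I_n, i.+1 \in s -> ball (G i) r y.

Definition cech_simplices G r : {fset {fset nat}} :=
  [fset s in fpowerset [fset k in iota 1 n] | `[< cech_simplex G r s >]]%fset.

Fact cech_neq0 G r s : s \in cech_simplices G r -> s != fset0.
Proof. by rewrite !inE => /andP[_ /asboolP[]]. Qed.

Fact cech_closed G r s t : t \in cech_simplices G r -> s != fset0 ->
  (s `<=` t)%fset -> s \in cech_simplices G r.
Proof.
rewrite !inE !fpowersetE => /andP[tn /asboolP[_ [y yP]]] s0 st.
rewrite (fsubset_trans st tn); apply/asboolP; split => //; exists y => i si.
by apply: yP; apply: (fsubsetP st).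
Qed.

Definition cech G r : simplicial_complex :=
  SimplicialComplex (@cech_neq0 G r) (@cech_closed G r).

Definition sample_radius G : R :=
  inf [set r | 0 <= r /\ forall i j : 'I_n, j = i.+1 :> nat ->
    ball (G i) r `&` ball (G j) r !=set0].

Definition grid_intervals : seq elem_interval :=
  [seq u <- [seq (k, b) | k <- iota 1 n, b <- [:: false; true]] | (hi u <= n)%N].

Definition grid_cubes : seq cube :=
  [seq (u, v) | u <- grid_intervals, v <- grid_intervals].

Definition in_dc G r (c : cube) : bool :=
  (hi c.1 <= lo c.2)%N &&
  ([fset lo c.1; hi c.1; lo c.2; hi c.2]%fset \in cech_simplices G r).

Definition dc_cubes G r : {fset cube} := [fset c in grid_cubes | in_dc G r c]%fset.

Lemma mem_grid_intervals (I : elem_interval) :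
  (I \in grid_intervals) = (0 < lo I)%N && (hi I <= n)%N.
Proof.
rewrite mem_filter andbC; case: I => k b.
have [kn|] := boolP (hi (k, b) <= n)%N; rewrite ?andbF // !andbT.
apply/allpairsP/idP => [[p [+ _ [-> _]]]|k0]; first by rewrite mem_iota => /andP[].
exists (k, b); rewrite mem_iota; move: k0 kn; rewrite /lo /hi /= => k0 kn.
by split; [lia | case: b {kn} |].
Qed.

Lemma mem_dc G r (c : cube) : (c \in dc_cubes G r) =
  [&& c.1 \in grid_intervals, c.2 \in grid_intervals, (hi c.1 <= lo c.2)%N &
    [fset lo c.1; hi c.1; lo c.2; hi c.2]%fset \in cech_simplices G r].
Proof.
have -> : (c \in dc_cubes G r) = (c \in grid_cubes) && in_dc G r c by rewrite !inE.
rewrite andbA; congr (_ && _).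
apply/allpairsP/andP => [[[u v] [? ? ->]] //|[? ?]].
by exists c; rewrite -surjective_pairing.
Qed.

Fact dc_closed G r (c d : cube) : d \in dc_cubes G r -> face c d -> c \in dc_cubes G r.
Proof.
rewrite !mem_dc !mem_grid_intervals /face /subinterval.
case/and4P=> d1 d2 hd sd /andP[c1 c2].
apply/and4P; split; [lia|lia|lia|].
apply: cech_closed sd _ _; first by apply/fset0Pn; exists (lo c.1); rewrite !inE eqxx.
apply/fsubsetP => x; rewrite !inE.
move: c1 c2; rewrite /lo /hi; case: c d {d1 d2 hd} => [[a [] ] [b [] ]] [[a' [] ] [b' [] ]] /=; lia.
Qed.

Definition dc G r : cubical_complex := CubicalComplex (@dc_closed G r).

End PointCloud.

Lemma zmod_edge1 (V : zmodType) (a b e p : V) :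
  - (a - b + e) = (p - a) - ((e + p) - b).
Proof.
rewrite [p - a]addrC [e + p]addrC -[p + e - b]addrA addrKA -addrA opprD.
by rewrite [- b + e]addrC.
Qed.

Lemma zmod_edge2 (V : zmodType) (a b e p : V) :
  e - a + b = (p + e - a) - (p - b).
Proof.
by rewrite [p + e]addrC -[e + p - a]addrA [p - a]addrC addrA addrKA opprK.
Qed.

Lemma zmod_cell2 (V : zmodType) (a b e f : V) :
  a - b + e - f = a - b - (- e) + (- f).
Proof. by rewrite opprK. Qed.

Section DistanceToCech.
Context (R : realType) (X : metricType R) (n : nat) (L : pzRingType).
Context (G : 'I_n -> X) (r : R).

Local Notation sC k := (simplicial_chains L (cech G r) k).
Local Notation sb k := (symb L (cech G r) k).

Definition path_chain (i j : nat) : sC 1 := \sum_(i.+1 <= k < j.+1) sb 1 [:: k.-1; k].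

(* When [c] is in [dc G r] and [r] exceeds the sample radius, the vertex sets of
   all symbols below are simplices of [cech G r] (see [dc_cech], [cech_pair]),
   so no term is discarded by [gen]. *)
Definition psi_cell k : cube -> sC k.+1 :=
  match k with
  | 0 => fun c => let i := lo c.1 in let j := lo c.2 in path_chain i j - sb 1 [:: i; j]
  | 1 => fun c => let i := lo c.1 in let j := lo c.2 in
      if c.1.2 then sb 2 [:: i; j; i.+1] else sb 2 [:: i; j; j.+1]
  | 2 => fun c => let i := lo c.1 in let j := lo c.2 in sb 3 [:: i; i.+1; j; j.+1]
  | _ => fun=> 0
  end.

Definition psi_lin k : {linear cubical_chains L (dc G r) k -> sC k.+1} :=
  linext (psi_cell k).

Lemma psi_lin_gen k c : c \in cubes_of_dim (dc G r) k ->
  psi_lin k (gen L (cubes_of_dim (dc G r) k) c) = psi_cell k c.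
Proof. exact: linext_gen. Qed.

Lemma cech_pair i : sample_radius G < r -> (0 < i)%N -> (i < n)%N ->
  [fset x in [:: i; i.+1]] \in cech_simplices G r.
Proof.
move=> hr i0 i_n.
rewrite !inE fpowersetE; apply/andP; split.
  by apply/fsubsetP => x; rewrite !inE mem_iota; lia.
apply/asboolP; split; first by apply/fset0Pn; exists i; rewrite !inE eqxx.
have [|e [e0 eP] er] := inf_lt _ hr.
  pose D := \sum_(a : 'I_n) \sum_(b : 'I_n) mdist (G a) (G b).
  have D0 : 0 <= D by do 2 (apply: sumr_ge0 => ? _); apply: mdist_ge0.
  exists (1 + D); split=> [|a b _]; first by rewrite addr_ge0.
  exists (G b); split; last by rewrite ballEmdist /= mdistxx ltr_pwDl.
  rewrite ballEmdist /= ltr_pwDl // /D (bigD1 a) //= (bigD1 b) //= -addrA lerDl.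
  by rewrite addr_ge0 //; do ?(apply: sumr_ge0 => ? _); rewrite ?mdist_ge0.
have i1n : (i.-1 < n)%N by lia.
have [y [y1 y2]] := eP (Ordinal i1n) (Ordinal i_n) (esym (prednK i0)).
exists y => a; rewrite !inE => /orP[] /eqP ea.
  by apply: le_ball (ltW er) _ _; rewrite (_ : a = Ordinal i1n) //; apply: val_inj => /=; lia.
by apply: le_ball (ltW er) _ _; rewrite (_ : a = Ordinal i_n) //; apply: val_inj => /=; lia.
Qed.

Lemma dc_cech c (s : seq nat) : c \in dc_cubes G r -> (0 < size s)%N ->
  {subset s <= [:: lo c.1; hi c.1; lo c.2; hi c.2]} ->
  [fset x in s] \in cech_simplices G r.
Proof.
rewrite mem_dc => /and4P[_ _ _ cC] s0 sc.
apply: cech_closed cC _ _.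
  by case: s s0 sc => // x s _ _; apply/fset0Pn; exists x; rewrite !inE eqxx.
by apply/fsubsetP => x; rewrite !inE -!orbA => /sc; rewrite !inE.
Qed.

Hypothesis hr : sample_radius G < r.

Lemma psi_bd0 x : bd (simplicial_chains L (cech G r)) 0 (psi_lin 0 x) = 0.
Proof.
pose f : {linear cubical_chains L (dc G r) 0 -> sC 0} :=
  bd (simplicial_chains L (cech G r)) 0 \o psi_lin 0.
pose z : {linear cubical_chains L (dc G r) 0 -> sC 0} := \0.
suff: f x = z x by [].
apply: linear_genP => c cK; rewrite /f /z /= psi_lin_gen //.
move: cK; rewrite mem_cubes_of_dim /cube_dim => /andP[cK].
have := (cK : c \in dc_cubes G r); rewrite mem_dc !mem_grid_intervals.
move: cK; case: c => [[i [] ] [j [] ]] //= cK /and4P[].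
rewrite /lo /hi /= ?addn0 => /andP[i0 i_n] /andP[j0 jn] ij _ _.
rewrite linearB /= bd_symb2 //; last first.
  by apply: dc_cech cK _ _ => // y; rewrite /lo /hi /= ?addn0 !inE; lia.
rewrite linear_sum /= big_add1 /= (telescope_sumr_eq (fun k => sb 0 [:: k])) ?subrr //.
move=> k /andP[ik kj]; rewrite bd_symb2 //.
by apply: cech_pair => //; lia.
Qed.

Lemma psi_bdS k x : bd (simplicial_chains L (cech G r)) k.+1 (psi_lin k.+1 x) =
  psi_lin k (bd (cubical_chains L (dc G r)) k x).
Proof.
pose f : {linear cubical_chains L (dc G r) k.+1 -> sC k.+1} :=
  bd (simplicial_chains L (cech G r)) k.+1 \o psi_lin k.+1.
pose g : {linear cubical_chains L (dc G r) k.+1 -> sC k.+1} :=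
  psi_lin k \o bd (cubical_chains L (dc G r)) k.
suff: f x = g x by [].
apply: linear_genP => c cK; rewrite /f /g /= psi_lin_gen // cubical_bd_gen //.
move: cK; rewrite mem_cubes_of_dim => /andP[cK /eqP dk].
have fK d : face d c -> cube_dim d == k -> d \in cubes_of_dim (dc G r) k.
  by move=> fc dd; rewrite mem_cubes_of_dim dd andbT; apply: dc_closed fc.
have := (cK : c \in dc_cubes G r); rewrite mem_dc !mem_grid_intervals.
move: cK dk fK; rewrite {1}/cube_dim.
case: c => [[i [] ] [j [] ]] cK /= dk fK; try by []; case: dk => dk; subst k;
  rewrite /lo /hi /= ?addn0 ?addn1 => /and4P[/andP[i0 i_n] /andP[j0 jn] ij _].
- rewrite linearD !linearB /= !psi_lin_gen ?fK //=;
    try by rewrite /face /subinterval /lo /hi /=; lia.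
  rewrite bd_symb4 //; last first.
    by apply: dc_cech cK _ _ => // y; rewrite /lo /hi /= !inE; lia.
  rewrite (@symb_swap23 L (cech G r) 2 i j.+1 i.+1) ?(@symb_swap23 L (cech G r) 2 i j i.+1).
  + exact: zmod_cell2.
  + by lia.
  + by lia.
- rewrite linearB /= !psi_lin_gen ?fK //=;
    try by rewrite /face /subinterval /lo /hi /=; lia.
  rewrite symb_swap23; last by lia.
  rewrite linearN /= bd_symb3; last 2 first.
  + by lia.
  + by apply: dc_cech cK _ _ => // y; rewrite /lo /hi /= !inE; lia.
  rewrite /path_chain [X in _ - (X - _)]big_ltn //=.
  exact: zmod_edge1.
- rewrite linearB /= !psi_lin_gen ?fK //=;
    try by rewrite /face /subinterval /lo /hi /=; lia.
  rewrite bd_symb3 //; last 2 first.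
  + by lia.
  + by apply: dc_cech cK _ _ => // y; rewrite /lo /hi /= !inE; lia.
  rewrite /path_chain [X in (X - _) - _]big_nat_recr //=.
  exact: zmod_edge2.
Qed.

Definition psi : degree1_chain_map (cubical_chains L (dc G r)) (simplicial_chains L (cech G r)) :=
  Degree1ChainMap psi_bd0 psi_bdS.

End DistanceToCech.

(* Main.v *)
Require Import Defs.
From mathcomp Require Import all_boot all_order all_algebra.
From mathcomp Require Import all_classical all_reals all_analysis.
From mathcomp Require Import finmap zify.

(** Moving every point by at most [e] turns a common point of the balls of
    radius [r] into a common point of the balls of radius [r + e], by the
    triangle inequality. Hence the Cech complex of one cloud at radius [r] is a
    subcomplex of that of the other cloud at radius [r + e]
    ([cech_perturbation]), and since a cube lies in the distance complex exactly
    when its coordinates satisfy a condition independent of the cloud and span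
    a Cech simplex, the same holds for distance complexes
    ([dc_perturbation]).

    An inclusion of complexes induces an injective chain map because the
    boundary of a cell is a formula in its faces which does not see the ambient
    complex ([cubical_inclusion], [simplicial_inclusion]). The value of psi on
    a cube is likewise a combination of symbols of index tuples which depends
    only on the cube, so the two composites agree on generators
    ([psi_natural]).

    The one point that needs care is that a generator outside the complex
    counts as zero, so a formula is sure to be preserved by the inclusion only
    when all its terms lie in the smaller complex. For boundaries this is
    closure under faces; for psi the vertices of a symbol are coordinates of the
    cube, or two consecutive indices, whose balls meet because [r] exceeds the
    sample radius. *)

Set Implicit Arguments.
Unset Strict Implicit.
Unset Printing Implicit Defensive.
Import Order.TTheory GRing.Theory Num.Theory.
Local Open Scope fset_scope.
Local Open Scope ring_scope.

Section FreeInclusion.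
Context (L : pzRingType) (T : choiceType).
Implicit Types S : {fset T}.

(** Extending by zero does not disturb the old coordinates; injectivity of the
    inclusion is read off from this. *)
Lemma linext_gen_coord S S' (x : freemod L S) (t : S) (tS' : val t \in S') :
  linext (gen L S') x [` tS'] = x t.
Proof.
rewrite /linext sum_ffunE (bigD1 t) //= !ffunE eqxx big1 ?addr0.
  by rewrite /GRing.scale /= mulr1.
by move=> s st; rewrite !ffunE eq_sym (inj_eq val_inj) (negbTE st) scaler0.
Qed.

Lemma linext_gen_inj S S' : S `<=` S' ->
  injective (linext (gen L S') : freemod L S -> freemod L S').
Proof.
move=> sS x y xy; apply/ffunP => t.
have tS' := fsubsetP sS _ (valP t).
by rewrite -(linext_gen_coord x tS') -(linext_gen_coord y tS') xy.
Qed.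

End FreeInclusion.

Lemma cubical_inclusion (L : pzRingType) (K K' : cubical_complex) :
  K `<=` K' -> induces_cubical_inclusion L K K'.
Proof.
move=> sK; split=> // k; last first.
  apply: linext_gen_inj; apply/fsubsetP => c.
  by rewrite !mem_cubes_of_dim => /andP[cK ->]; rewrite (fsubsetP sK).
move=> x.
pose f : {linear cubical_chains L K k.+1 -> cubical_chains L K' k} :=
  bd (cubical_chains L K') k \o cubical_incl L K K' k.+1.
pose g : {linear cubical_chains L K k.+1 -> cubical_chains L K' k} :=
  cubical_incl L K K' k \o bd (cubical_chains L K) k.
suff: f x = g x by [].
apply: linear_genP => c cK; rewrite /f /g /= linext_gen //.
move: cK; rewrite mem_cubes_of_dim => /andP[cK dc].
rewrite !cubical_bd_gen ?mem_cubes_of_dim ?dc ?cK ?(fsubsetP sK) //.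
have fK d : face d c -> cube_dim d == k -> d \in cubes_of_dim K k.
  by move=> fc dd; rewrite mem_cubes_of_dim dd (cubes_closed cK fc).
move: dc fK {cK}; rewrite {1}/cube_dim.
case: c => [[i [] ] [j [] ]] //= /eqP [] k0 fK; subst k;
  rewrite !(linearD, linearN) /= !linext_gen ?fK //=;
  by rewrite /face /subinterval /lo /hi /=; lia.
Qed.

Lemma simplicial_inclusion (L : pzRingType) (K K' : simplicial_complex) :
  K `<=` K' -> induces_simplicial_inclusion L K K'.
Proof.
move=> sK.
have sKk k : simplices_of_dim K k `<=` simplices_of_dim K' k.
  apply/fsubsetP => s; rewrite !inE => /andP[sK1 ->].
  by rewrite (fsubsetP sK).
split=> // k; last exact: linext_gen_inj.
move=> x.
pose f : {linear simplicial_chains L K k.+1 -> simplicial_chains L K' k} :=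
  bd (simplicial_chains L K') k \o simplicial_incl L K K' k.+1.
pose g : {linear simplicial_chains L K k.+1 -> simplicial_chains L K' k} :=
  simplicial_incl L K K' k \o bd (simplicial_chains L K) k.
suff: f x = g x by [].
apply: linear_genP => s sk; rewrite /f /g /= linext_gen //.
rewrite !simplicial_bd_gen ?(fsubsetP (sKk _)) // linear_sum /=.
rewrite /simplex_bd big_seq [RHS]big_seq; apply: eq_bigr => v vs.
rewrite linearZ /= linext_gen //.
move: sk; rewrite !inE => /andP[sk /eqP cs].
have cv : #|` s `\ v| = k.+1 by have := cardfsD1 v s; rewrite vs cs; lia.
rewrite cv eqxx andbT; apply: simplices_closed sk _ (fsubD1set _ _).
by rewrite -cardfs_gt0 cv.
Qed.

(** The symbol must be one of [K]: otherwise the left side vanishes, while the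
    right side need not. *)
Lemma simplicial_incl_symb (L : pzRingType) (K K' : simplicial_complex) k
    (v : seq nat) :
  size v = k.+1 -> [fset x in v] \in simplices K ->
  simplicial_incl L K K' k (symb L K k v) = symb L K' k v.
Proof.
move=> sv vK; rewrite /symb; case: ifP => [uv|_]; last by rewrite linear0.
by rewrite linearZ /= linext_gen // !inE vK /= card_fseq undup_id // sv.
Qed.

Section Perturbation.
Context (R : realType) (X : metricType R) (n : nat).
Context (G G' : 'I_n -> X) (r e : R).
Hypothesis GG' : forall i, mdist (G i) (G' i) <= e.

Lemma cech_perturbation : cech G r `<=` cech G' (r + e).
Proof.
apply/fsubsetP => s; rewrite !inE => /andP[-> /asboolP[s0 [y yP]]] /=.
apply/asboolP; split=> //; exists y => i /yP.
rewrite !ballEmdist /= => iy.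
rewrite (le_lt_trans (metric_triangle _ (G i) _)) // addrC ltr_leD //.
by rewrite metric_sym.
Qed.

Lemma dc_perturbation : dc G r `<=` dc G' (r + e).
Proof.
apply/fsubsetP => c; rewrite !mem_dc => /and4P[-> -> -> cs] /=.
exact: (fsubsetP cech_perturbation).
Qed.

End Perturbation.

(** On a generator both sides are the same combination of symbols, so
    everything rests on [simplicial_incl_symb]. Its hypothesis comes from
    [dc_cech] for symbols in the coordinates of the cube, and from [cech_pair]
    for the edges of the path chain, whose indices also lie between those
    coordinates. *)
Lemma psi_natural (R : realType) (X : metricType R) (L : pzRingType) (n : nat)
    (G G' : 'I_n -> X) (r r' : R)
    (hr : sample_radius G < r) (hr' : sample_radius G' < r') k
    (x : cubical_chains L (dc G r) k) :
  dc G r `<=` dc G' r' ->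
  simplicial_incl L (cech G r) (cech G' r') k.+1 (psi L hr k x) =
  psi L hr' k (cubical_incl L (dc G r) (dc G' r') k x).
Proof.
move=> sdc.
pose f : {linear cubical_chains L (dc G r) k ->
                 simplicial_chains L (cech G' r') k.+1} :=
  simplicial_incl L (cech G r) (cech G' r') k.+1 \o psi L hr k.
pose g : {linear cubical_chains L (dc G r) k ->
                 simplicial_chains L (cech G' r') k.+1} :=
  psi L hr' k \o cubical_incl L (dc G r) (dc G' r') k.
suff: f x = g x by [].
apply: linear_genP => c cK; rewrite /f /g /= psi_lin_gen // linext_gen //.
move: cK; rewrite mem_cubes_of_dim => /andP[cK dimc].
rewrite psi_lin_gen; last by rewrite mem_cubes_of_dim dimc (fsubsetP sdc).
have symbE m v : size v = m.+1 ->
    {subset v <= [:: lo c.1; hi c.1; lo c.2; hi c.2]} ->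
    simplicial_incl L (cech G r) (cech G' r') m (symb L (cech G r) m v) =
    symb L (cech G' r') m v.
  move=> sv vc; apply: simplicial_incl_symb => //.
  by apply: dc_cech cK _ vc; rewrite sv.
have := cK; rewrite mem_dc !mem_grid_intervals.
case/and4P=> /andP[i0 _] /andP[_ jn] _ _.
move: dimc symbE i0 jn {cK}; rewrite /cube_dim.
case: c => [[i [] ] [j [] ]] /= /eqP <- symbE;
  rewrite /lo /hi /= ?addn0 ?addn1 in symbE * => i0 jn.
- by rewrite symbE // => y; rewrite !inE; lia.
- by rewrite symbE // => y; rewrite !inE; lia.
- by rewrite symbE // => y; rewrite !inE; lia.
rewrite linearB /= symbE //; last by move=> y; rewrite !inE; lia.
congr (_ - _); rewrite /path_chain linear_sum !big_nat.
apply: eq_bigr => -[//|m] /andP[im mj].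
apply: simplicial_incl_symb => //; apply: cech_pair => //; lia.
Qed.

Theorem theorem4p8 (R : realType) (X : metricType R) (L : pzRingType)
    (n : nat) (G G' : 'I_n -> X) (r : R) :
  let eps := \big[Num.max/0]_(i < n) mdist (G i) (G' i) in
  Num.max (sample_radius G) (sample_radius G') < r ->
  [/\ induces_cubical_inclusion L (dc G r) (dc G' (r + eps)),
      induces_simplicial_inclusion L (cech G r) (cech G' (r + eps)),
      induces_cubical_inclusion L (dc G' r) (dc G (r + eps)) &
      induces_simplicial_inclusion L (cech G' r) (cech G (r + eps))] /\
  exists (hr : sample_radius G < r) (hr' : sample_radius G' < r)
         (hre : sample_radius G < r + eps) (hre' : sample_radius G' < r + eps),
    (forall k (x : cubical_chains L (dc G r) k),
       simplicial_incl L (cech G r) (cech G' (r + eps)) k.+1 (psi L hr k x) =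
       psi L hre' k (cubical_incl L (dc G r) (dc G' (r + eps)) k x)) /\
    (forall k (x : cubical_chains L (dc G' r) k),
       simplicial_incl L (cech G' r) (cech G (r + eps)) k.+1 (psi L hr' k x) =
       psi L hre k (cubical_incl L (dc G' r) (dc G (r + eps)) k x)).
Proof.
move=> eps; rewrite gt_max => /andP[hr hr'].
have GG' i : mdist (G i) (G' i) <= eps by apply: le_bigmax_cond.
have G'G i : mdist (G' i) (G i) <= eps by rewrite metric_sym.
have eps0 : 0 <= eps by apply: bigmax_ge_id.
have hre s : s < r -> s < r + eps by move=> sr; rewrite ltr_wpDr.
split; first split.
- exact/cubical_inclusion/dc_perturbation.
- exact/simplicial_inclusion/cech_perturbation.
- exact/cubical_inclusion/dc_perturbation.
- exact/simplicial_inclusion/cech_perturbation.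
exists hr, hr', (hre _ hr), (hre _ hr').
by split=> k x; apply/psi_natural/dc_perturbation.
Qed.
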